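(* Let $\star$ be a finite-type star operation on a domain $R$. (1) If $M$ is a $\star$-super potent maximal $\star$-ideal of $R$, then $M$ is a $t$-super potent maximal $t$-ideal of $R$. (2) If $R$ is $\star$-super potent, then $R$ is $t$-super potent.
   Context: For a domain $R$ with quotient field $K$, let $\mathcal F(R)$ be the set of nonzero fractional ideals of $R$. A star operation on $R$ is a map $\star:\mathcal F(R)\to\mathcal F(R)$, $A\mapsto A^\star$, such that for all $A,B\in\mathcal F(R)$ and $c\in K\setminus(0)$: $(cA)^\star=cA^\star$ and $R^\star=R$; $A\subseteq A^\star$, and $A\subseteq B$ implies $A^\star\subseteq B^\star$; $(A^\star)^\star=A^\star$. It has finite type if, for every $A\in\mathcal F(R)$, $A^\star=\bigcup J^\star$, the union over all nonzero finitely generated subideals $J$ of $A$. For $I\in\mathcal F(R)$ put $I^{-1}=\{x\in K: xI\subseteq R\}$ and $I^v=(I^{-1})^{-1}$; the $t$-operation is the finite-type star operation $I^t=\bigcup J^v$, the union over nonzero finitely generated subideals $J$ of $I$. Let $\star$ be a finite-type star operation on $R$. A $\star$-ideal is a nonzero ideal $I$ with $I^\star=I$. A maximal $\star$-ideal is an ideal of $R$ maximal among the proper $\star$-ideals. A nonzero ideal $I$ is $\star$-invertible if $(II^{-1})^\star=R$. A nonzero finitely generated ideal $I$ of $R$ is $\star$-rigid if it is contained in exactly one maximal $\star$-ideal, and $\star$-super rigid if, in addition, every finitely generated ideal $J\supseteq I$ of $R$ is $\star$-invertible. A maximal $\star$-ideal is $\star$-super potent if it contains a $\star$-super rigid ideal;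 $R$ is $\star$-super potent if each maximal $\star$-ideal of $R$ is $\star$-super potent. *)

(* Defs.v *)
From HB Require Import structures.
From mathcomp Require Import all_boot all_order all_algebra.
From mathcomp Require Import boolp classical_sets.

Set Implicit Arguments.
Unset Strict Implicit.
Unset Printing Implicit Defensive.

Import GRing.Theory.

Local Open Scope classical_set_scope.
Local Open Scope ring_scope.

(* All ideals, fractional or integral, are subsets of the quotient field
   [{fraction R}], in which [R] is identified with its image [ring_set R].
   A star operation is a map on all such subsets that is only constrained,
   and only ever evaluated, on nonzero fractional ideals. *)

Section StarOperations.

Variable R : idomainType.
Local Notation K := {fraction R}.
Local Notation "r %:F" := (@FracField.tofrac R r).

Definition ring_set : set K := range (@FracField.tofrac R).

Definition is_submodule (A : set K) : Prop :=
  [/\ A 0,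
      forall x y, A x -> A y -> A (x + y) &
      forall (r : R) x, A x -> A (r%:F * x)].

Definition is_nonzero (A : set K) : Prop := exists2 x, A x & x != 0.

Definition fractional_ideal (A : set K) : Prop :=
  [/\ is_submodule A, is_nonzero A &
      exists2 d : R, d != 0 & forall x, A x -> ring_set (d%:F * x)].

Definition is_ideal (I : set K) : Prop := is_submodule I /\ I `<=` ring_set.

Definition fin_gen (A : set K) : Prop :=
  exists (n : nat) (g : 'I_n -> K),
    A = [set x | exists r : 'I_n -> R, x = \sum_(i < n) (r i)%:F * g i].

Definition scale_set (c : K) (A : set K) : set K := [set c * x | x in A].

Definition ideal_mul (A B : set K) : set K :=
  [set z | exists (n : nat) (a b : 'I_n -> K),
     [/\ forall i, A (a i), forall i, B (b i) & z = \sum_(i < n) a i * b i]].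

Definition ideal_inv (I : set K) : set K :=
  [set x | scale_set x I `<=` ring_set].

Definition fg_sub (A : set K) : set (set K) :=
  [set J | [/\ is_nonzero J, fin_gen J & J `<=` A]].

Definition star_operation (star : set K -> set K) : Prop :=
  [/\ forall A, fractional_ideal A -> fractional_ideal (star A),
      (forall A c, fractional_ideal A -> c != 0 ->
         star (scale_set c A) = scale_set c (star A))
        /\ star ring_set = ring_set,
      forall A, fractional_ideal A -> A `<=` star A,
      forall A B, fractional_ideal A -> fractional_ideal B ->
        A `<=` B -> star A `<=` star B &
      forall A, fractional_ideal A -> star (star A) = star A].

Definition finite_type (star : set K -> set K) : Prop :=
  forall A, fractional_ideal A -> star A = \bigcup_(J in fg_sub A) star J.

Definition v_op (I : set K) : set K := ideal_inv (ideal_inv I).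

Definition t_op (I : set K) : set K := \bigcup_(J in fg_sub I) v_op J.

Section FixedStar.

Variable star : set K -> set K.

Definition star_ideal (I : set K) : Prop :=
  [/\ is_ideal I, is_nonzero I & star I = I].

Definition maximal_star_ideal (M : set K) : Prop :=
  [/\ star_ideal M, M <> ring_set &
      forall N, star_ideal N -> N <> ring_set -> M `<=` N -> N = M].

Definition star_invertible (I : set K) : Prop :=
  [/\ is_ideal I, is_nonzero I & star (ideal_mul I (ideal_inv I)) = ring_set].

Definition star_rigid (I : set K) : Prop :=
  [/\ is_ideal I, is_nonzero I, fin_gen I &
      exists! M, maximal_star_ideal M /\ I `<=` M].

Definition star_super_rigid (I : set K) : Prop :=
  star_rigid I /\
  forall J, is_ideal J -> fin_gen J -> I `<=` J -> star_invertible J.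

Definition star_super_potent_ideal (M : set K) : Prop :=
  maximal_star_ideal M /\ exists2 I, star_super_rigid I & I `<=` M.

Definition star_super_potent : Prop :=
  forall M, maximal_star_ideal M -> star_super_potent_ideal M.

End FixedStar.

End StarOperations.

Arguments ring_set R : clear implicits.
Arguments t_op R : clear implicits.

(* Main.v *)
Require Import Defs.
From mathcomp Require Import all_boot all_order all_algebra.
From mathcomp Require Import boolp classical_sets.

(** The idea: a finite-type star operation [star] satisfies
    [star A `<=` t_op R A `<=` v_op A], so every t-ideal is a star-ideal and
    star-invertibility implies t-invertibility.  Conversely, if [J] is
    star-invertible then [v_op J `<=` star J], because [x J^-1 `<=` R] gives
    [x (J J^-1) `<=` J], and applying [star] turns [J J^-1] into [R].

    Let [M] be a maximal star-ideal containing a star-super rigid ideal [I].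
    Every finitely generated [J `<=` M] lies in the finitely generated ideal
    [I + J `<=` M], which is star-invertible; hence
    [v_op J `<=` v_op (I + J) `<=` star (I + J) `<=` M], that is, [M] is a
    t-ideal ([super_potent_t_ideal]).  As t-ideals are star-ideals, [M] is also
    maximal among the proper t-ideals.  Any other maximal t-ideal containing
    [I] is a proper star-ideal, hence lies in some maximal star-ideal
    ([exists_maximal_star_ideal], Zorn's lemma and finite type), which can only
    be [M] by rigidity; by maximality it is [M].  So [I] is t-super rigid.  The
    same enlargement argument turns a maximal t-ideal of a star-super potent
    domain into a maximal star-ideal that is itself a maximal t-ideal, so the two
    coincide and super potency passes from [star] to t on the whole domain. *)

Set Implicit Arguments.
Unset Strict Implicit.
Unset Printing Implicit Defensive.

Import GRing.Theory.

Local Open Scope classical_set_scope.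
Local Open Scope ring_scope.

(** * Submodules of the quotient field *)

Section Submodules.

Variable R : idomainType.
Local Notation K := {fraction R}.
Local Notation "r %:F" := (@FracField.tofrac R r).
Implicit Types (A B I J : set K) (x y c : K).

Lemma submodule_sum A n (f : 'I_n -> K) :
  is_submodule A -> (forall i, A (f i)) -> A (\sum_(i < n) f i).
Proof. by case=> A0 AD _ Af; apply: big_ind => // i _; exact: Af. Qed.

Lemma ring_set_submodule : is_submodule (ring_set R).
Proof.
split; first by exists 0; rewrite // tofrac0.
- by move=> _ _ [r _ <-] [s _ <-]; exists (r + s); rewrite // tofracD.
- by move=> r _ [s _ <-]; exists (r * s); rewrite // tofracM.
Qed.

Lemma ring_set1 : ring_set R 1.
Proof. by exists 1; rewrite // tofrac1. Qed.

Lemma submodule_ring_mul A x y :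
  is_submodule A -> ring_set R x -> A y -> A (x * y).
Proof. by case=> _ _ AZ [r _ <-]; exact: AZ. Qed.

Lemma ideal_eq_ring I : is_ideal I -> I 1 -> I = ring_set R.
Proof.
case=> Isub Ile I1; apply/seteqP; split=> // x Rx.
by rewrite -[x]mulr1; exact: submodule_ring_mul.
Qed.

Lemma fractional_ideal_of_ideal I :
  is_ideal I -> is_nonzero I -> fractional_ideal I.
Proof.
case=> Isub Ile I0; split=> //; exists 1; first exact: oner_neq0.
by move=> x Ix; rewrite tofrac1 mul1r; exact: Ile.
Qed.

Lemma ring_set_fractional : fractional_ideal (ring_set R).
Proof.
apply: fractional_ideal_of_ideal.
- by split=> //; exact: ring_set_submodule.
- by exists 1; [exact: ring_set1 | exact: oner_neq0].
Qed.

Lemma nonzero_subset A B : A `<=` B -> is_nonzero A -> is_nonzero B.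
Proof. by move=> AB [x Ax x0]; exists x => //; exact: AB. Qed.

Lemma scale_submodule c A : is_submodule A -> is_submodule (scale_set c A).
Proof.
case=> A0 AD AZ; split; first by exists 0; rewrite ?mulr0.
- by move=> _ _ [x Ax <-] [y Ay <-]; exists (x + y); rewrite ?mulrDr //; exact: AD.
- by move=> r _ [x Ax <-]; exists (r%:F * x); rewrite 1?mulrCA //; exact: AZ.
Qed.

Lemma scale_nonzero c A :
  c != 0 -> is_nonzero A -> is_nonzero (scale_set c A).
Proof.
by move=> c0 [x Ax x0]; exists (c * x); [exists x | rewrite mulf_neq0].
Qed.

(** * Finitely generated submodules *)

Lemma fin_gen_submodule A : fin_gen A -> is_submodule A.
Proof.
case=> n [g ->]; split.
- by exists (fun=> 0); rewrite big1 // => i _; rewrite tofrac0 mul0r.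
- move=> _ _ [r ->] [s ->]; exists (fun i => r i + s i).
  by rewrite -big_split; apply: eq_bigr => i _; rewrite tofracD mulrDl.
- move=> r _ [s ->]; exists (fun i => r * s i).
  by rewrite mulr_sumr; apply: eq_bigr => i _; rewrite tofracM mulrA.
Qed.

Lemma fg_sub_fractional A J :
  fractional_ideal A -> fg_sub A J -> fractional_ideal J.
Proof.
case=> _ _ [d d0 dA] [J0 /fin_gen_submodule Jsub JA]; split=> //.
by exists d => // x /JA; exact: dA.
Qed.

Definition sum_set A B : set K :=
  [set z | exists x y, [/\ A x, B y & z = x + y]].

Lemma fin_gen_sum A B : fin_gen A -> fin_gen B -> fin_gen (sum_set A B).
Proof.
case=> n [g ->] [m [h ->]]; exists (n + m)%N.
exists (fun k => match split k with inl i => g i | inr j => h j end).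
have splitE (r : 'I_(n + m) -> R) :
    \sum_(k < n + m)
      (r k)%:F * match split k with inl i => g i | inr j => h j end =
    \sum_(i < n) (r (lshift m i))%:F * g i
      + \sum_(j < m) (r (rshift n j))%:F * h j.
  rewrite big_split_ord /=; congr (_ + _); apply: eq_bigr => i _.
  - by rewrite (unsplitK (inl i)).
  - by rewrite (unsplitK (inr i)).
apply/seteqP; split=> z.
- case=> _ [_ [[r ->] [s ->] ->]].
  exists (fun k => match split k with inl i => r i | inr j => s j end).
  rewrite splitE; congr (_ + _); apply: eq_bigr => i _.
  + by rewrite (unsplitK (inl i)).
  + by rewrite (unsplitK (inr i)).
- case=> r ->; rewrite splitE; do 2 eexists; split; last by [].
  + by exists (fun i => r (lshift m i)).
  + by exists (fun j => r (rshift n j)).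
Qed.

Lemma subset_suml A B : B 0 -> A `<=` sum_set A B.
Proof. by move=> B0 x Ax; exists x, 0; rewrite addr0. Qed.

Lemma subset_sumr A B : A 0 -> B `<=` sum_set A B.
Proof. by move=> A0 x Bx; exists 0, x; rewrite add0r. Qed.

Lemma sum_subset A B C :
  is_submodule C -> A `<=` C -> B `<=` C -> sum_set A B `<=` C.
Proof. by case=> _ CD _ AC BC _ [x [y [/AC Cx /BC Cy ->]]]; exact: CD. Qed.

Lemma bigcup_chain_finite (F : set (set K)) X0 n (g : 'I_n -> K) :
  F X0 -> total_on F subset ->
  (forall i, (\bigcup_(X in F) X) (g i)) ->
  exists2 X, F X & forall i, X (g i).
Proof.
move=> FX0 tot; elim: n g => [|n IHn] g Fg; first by exists X0 => // -[].
have [i|X FX Xg] := IHn (fun i => g (lift ord0 i)); first exact: Fg.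
have [Y FY Yg] := Fg ord0.
have [XY|YX] := tot _ _ FX FY.
- exists Y => // i; case: (unliftP ord0 i) => [j ->|-> //].
  exact/XY/Xg.
- exists X => // i; case: (unliftP ord0 i) => [j ->|->]; first exact: Xg.
  exact: YX.
Qed.

(** This compactness of finitely generated submodules is what lets a
    finite-type operation commute with unions of chains. *)
Lemma fin_gen_chain (F : set (set K)) X0 J :
  F X0 -> total_on F subset -> (forall X, F X -> is_submodule X) ->
  fin_gen J -> J `<=` \bigcup_(X in F) X ->
  exists2 X, F X & J `<=` X.
Proof.
move=> FX0 tot Fsub [n [g ->]] JF.
have [i|X FX Xg] := @bigcup_chain_finite F X0 n g FX0 tot.
  apply: JF; exists (fun j => (j == i)%:R).
  rewrite (bigD1 i) //= eqxx tofrac1 mul1r big1 ?addr0 // => j /negbTE ->.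
  by rewrite tofrac0 mul0r.
exists X => // _ [r ->]; have Xsub := Fsub _ FX.
by apply: submodule_sum => // i; case: Xsub => _ _; apply.
Qed.

Lemma bigcup_chain_submodule (F : set (set K)) X0 :
  F X0 -> total_on F subset -> (forall X, F X -> is_submodule X) ->
  is_submodule (\bigcup_(X in F) X).
Proof.
move=> FX0 tot Fsub; split.
- by exists X0 => //; case: (Fsub _ FX0).
- move=> x y [X FX Xx] [Y FY Yy]; have [XY|YX] := tot _ _ FX FY.
  + by exists Y => //; case: (Fsub _ FY) => _ YD _; apply: YD => //; exact: XY.
  + by exists X => //; case: (Fsub _ FX) => _ XD _; apply: XD => //; exact: YX.
- by move=> r x [X FX Xx]; exists X => //; case: (Fsub _ FX) => _ _; apply.
Qed.

(** * Products, inverses and the v- and t-operations *)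

Lemma ideal_mul_submodule A B :
  is_submodule A -> is_submodule (ideal_mul A B).
Proof.
move=> [A0 AD AZ]; split.
- by exists 0%N, (fun=> 0), (fun=> 0); split=> [[]|[]|] //; rewrite big_ord0.
- move=> _ _ [n [a [b [Aa Bb ->]]]] [m [a' [b' [Aa' Bb' ->]]]].
  exists (n + m)%N.
  exists (fun k => match split k with inl i => a i | inr j => a' j end).
  exists (fun k => match split k with inl i => b i | inr j => b' j end).
  split; [by move=> k; case: (split k) | by move=> k; case: (split k) |].
  rewrite big_split_ord /=; congr (_ + _); apply: eq_bigr => i _.
  + by rewrite !(unsplitK (inl i)).
  + by rewrite !(unsplitK (inr i)).
- move=> r _ [n [a [b [Aa Bb ->]]]].
  exists n, (fun i => r%:F * a i), b; split=> // [i|]; first exact: AZ.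
  by rewrite mulr_sumr; apply: eq_bigr => i _; rewrite mulrA.
Qed.

Lemma ideal_invP A x : ideal_inv A x <-> forall y, A y -> ring_set R (x * y).
Proof.
split; first by move=> h y Ay; apply: h; exists y.
by move=> h _ [y Ay <-]; exact: h.
Qed.

Lemma ideal_mul_inv_ideal I :
  is_submodule I -> is_ideal (ideal_mul I (ideal_inv I)).
Proof.
move=> Isub; split; first exact: ideal_mul_submodule.
move=> _ [n [a [b [Ia /(_ _)/ideal_invP Ib ->]]]].
apply: submodule_sum ring_set_submodule _ => i.
by rewrite mulrC; exact: Ib.
Qed.

(** An integral ideal satisfies [1 \in I^-1]; in particular [I I^-1] is nonzero,
    so star operations may be evaluated on it. *)
Lemma subset_mul_inv I :
  I `<=` ring_set R -> I `<=` ideal_mul I (ideal_inv I).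
Proof.
move=> Ile x Ix; exists 1%N, (fun=> x), (fun=> 1); split=> //.
- by move=> _; apply/ideal_invP => y /Ile; rewrite mul1r.
- by rewrite big_ord1 mulr1.
Qed.

Lemma v_op_mono A B : A `<=` B -> v_op A `<=` v_op B.
Proof.
move=> AB x /ideal_invP Ax; apply/ideal_invP => y /ideal_invP By.
by apply/Ax/ideal_invP => z /AB; exact: By.
Qed.

Lemma t_op_ring_subset I : I `<=` ring_set R -> t_op R I `<=` ring_set R.
Proof.
move=> Ile x [J [_ _ JI] /ideal_invP Jx].
rewrite -[x]mulr1; apply/Jx/ideal_invP => y Jy.
by rewrite mul1r; exact/Ile/JI.
Qed.

End Submodules.

(** * Comparison of a star operation with the v- and t-operations *)

Section Comparison.

Variables (R : idomainType) (star : set {fraction R} -> set {fraction R}).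
Hypothesis star_op : star_operation star.
Local Notation K := {fraction R}.
Implicit Types (A I J M N : set K).

Lemma star_subset A : fractional_ideal A -> A `<=` star A.
Proof. by case: star_op => _ _ + _ _; apply. Qed.

Lemma star_mono A B : fractional_ideal A -> fractional_ideal B ->
  A `<=` B -> star A `<=` star B.
Proof. by case: star_op => _ _ _ + _; apply. Qed.

Lemma star_scale A c : fractional_ideal A -> c != 0 ->
  star (scale_set c A) = scale_set c (star A).
Proof. by case: star_op => _ [+ _] _ _ _; apply. Qed.

Lemma star_ring : star (ring_set R) = ring_set R.
Proof. by case: star_op => _ [_ ->]. Qed.

(** [A^v] is the intersection of the principal fractional ideals [y^-1 R]
    containing [A], and each of these is fixed by [star]. *)
Lemma star_sub_v A : fractional_ideal A -> star A `<=` v_op A.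
Proof.
move=> fA x Ax; apply/ideal_invP => y yA; have [-> | y0] := eqVneq y 0.
  by rewrite mulr0; case: (ring_set_submodule R).
have yAfrac : fractional_ideal (scale_set y A).
  case: (fA) => Asub A0 _; apply: fractional_ideal_of_ideal.
  - by split=> //; exact: scale_submodule.
  - exact: scale_nonzero.
rewrite -star_ring; apply: star_mono yA _ _ => //.
  exact: ring_set_fractional.
by rewrite star_scale //; exists x; rewrite 1?mulrC.
Qed.

(** An element [x] of [J^v] multiplies [J J^-1] into [J]; as [star] sends
    [J J^-1] to [R], it follows that [x] multiplies [R] into [star J]. *)
Lemma v_sub_star J : star_invertible star J -> v_op J `<=` star J.
Proof.
case=> Jid J0 JJ x /ideal_invP xJ.
have Jfrac := fractional_ideal_of_ideal Jid J0.
have [Jsub Jle] := Jid.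
have [-> | x0] := eqVneq x 0.
  by apply: star_subset => //; case: Jsub.
pose P := ideal_mul J (ideal_inv J).
have Pid : is_ideal P by exact: ideal_mul_inv_ideal.
have P0 : is_nonzero P := nonzero_subset (subset_mul_inv Jle) J0.
have Pfrac := fractional_ideal_of_ideal Pid P0.
have xPJ : scale_set x P `<=` J.
  move=> _ [_ [n [a [b [Ja Jb ->]]]] <-].
  rewrite mulr_sumr; apply: submodule_sum => // i.
  rewrite mulrCA mulrC; apply: submodule_ring_mul => //.
  exact/xJ/Jb.
have xPfrac : fractional_ideal (scale_set x P).
  apply: fractional_ideal_of_ideal; last exact: scale_nonzero.
  split; last exact: subset_trans Jle.
  by apply: scale_submodule; case: Pid.
apply: star_mono xPJ _ _ => //.
by rewrite star_scale // JJ; exists 1; [exact: ring_set1 | rewrite mulr1].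
Qed.

Hypothesis star_fin : finite_type star.

Lemma star_sub_t A : fractional_ideal A -> star A `<=` t_op R A.
Proof.
move=> fA; rewrite star_fin // => x [J AJ Jx]; exists J => //.
by apply: star_sub_v => //; exact: fg_sub_fractional AJ.
Qed.

Lemma t_ideal_star_ideal N : star_ideal (t_op R) N -> star_ideal star N.
Proof.
case=> Nid N0 Nt; have Nfrac := fractional_ideal_of_ideal Nid N0.
split=> //; apply/seteqP; split; last exact: star_subset.
by rewrite -[X in _ `<=` X]Nt; exact: star_sub_t.
Qed.

Lemma star_invertible_t J : star_invertible star J -> star_invertible (t_op R) J.
Proof.
case=> Jid J0 JJ; split=> //; have [Jsub Jle] := Jid.
have Pid := ideal_mul_inv_ideal Jsub.
have P0 := nonzero_subset (subset_mul_inv Jle) J0.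
apply/seteqP; split; first by apply: t_op_ring_subset; case: Pid.
by rewrite -[X in X `<=` _]JJ; apply: star_sub_t; exact: fractional_ideal_of_ideal.
Qed.

(** * Maximal star-ideals *)

(** By finite type, the star-closure of the union is covered by the
    star-closures of its finitely generated subideals, and each of these
    subideals already lies in one member of the chain. *)
Lemma star_ideal_bigcup_chain (F : set (set K)) X0 :
  F X0 -> total_on F subset -> (forall X, F X -> star_ideal star X) ->
  star_ideal star (\bigcup_(X in F) X).
Proof.
move=> FX0 tot Fid.
have Fsub X : F X -> is_submodule X by case/Fid => -[].
have Uid : is_ideal (\bigcup_(X in F) X).
  split; first exact: bigcup_chain_submodule FX0 tot Fsub.
  by move=> x [X /Fid[[_ Xle] _ _] Xx]; exact: Xle.
have U0 : is_nonzero (\bigcup_(X in F) X).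
  by apply: (@nonzero_subset _ X0); [exact: bigcup_sup | case: (Fid _ FX0)].
have Ufrac := fractional_ideal_of_ideal Uid U0.
split=> //; apply/seteqP; split; last exact: star_subset.
rewrite [X in X `<=` _]star_fin // => x [J UJ Jx].
have [_ Jfg JU] := UJ.
have [X FX JX] := fin_gen_chain FX0 tot Fsub Jfg JU.
exists X => //; have [Xid Xn0 <-] := Fid _ FX.
apply: star_mono JX _ Jx; first exact: fg_sub_fractional UJ.
exact: fractional_ideal_of_ideal.
Qed.

Lemma star_ideal_proper N : star_ideal star N -> N <> ring_set R <-> ~ N 1.
Proof.
case=> Nid _ _; split=> [NR N1|N1 NR]; first exact/NR/ideal_eq_ring.
by apply: N1; rewrite NR; exact: ring_set1.
Qed.

Lemma exists_maximal_star_ideal N :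
  star_ideal star N -> N <> ring_set R ->
  exists2 M, maximal_star_ideal star M & N `<=` M.
Proof.
move=> Nid /(star_ideal_proper Nid) N1.
pose proper X := star_ideal star X /\ ~ X 1.
(* Adjoining [N] to every set makes the empty chain bounded by [N] itself. *)
have [|A [[NAid NA1] Amax]] := @Zorn_bigcup K (fun A => proper (N `|` A)).
  move=> F Fproper tot.
  pose G := [set N] `|` [set N `|` X | X in F].
  have GE : N `|` \bigcup_(X in F) X = \bigcup_(X in G) X.
    apply/seteqP; split=> x.
    - case=> [Nx|[X FX Xx]]; first by exists N => //; left.
      by exists (N `|` X); [right; exists X | right].
    - case=> _ [->|[X FX <-]]; first by left.
      by case=> [|Xx]; [left | right; exists X].
  have Gproper X : G X -> proper X.
    by case=> [->|[Y FY <-]] //; exact: Fproper.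
  rewrite GE; split; last by case=> X /Gproper[].
  apply: (@star_ideal_bigcup_chain G N) => [||X /Gproper[] //]; first by left.
  move=> _ _ [->|[X FX <-]] [->|[Y FY <-]].
  - by left.
  - by left; exact: subsetUl.
  - by right; exact: subsetUl.
  - by have [XY|YX] := tot _ _ FX FY; [left|right]; exact: setUS.
exists (N `|` A); last exact: subsetUl.
split=> //; first exact/(star_ideal_proper NAid).
move=> B Bid BR NAB; have B1 := (star_ideal_proper Bid).1 BR.
have NB : N `<=` B := subset_trans (@subsetUl _ _ _) NAB.
apply/seteqP; split=> //; apply: contrapT => nBA.
apply: (Amax B); last by rewrite (setUidr NB).
split; first exact: subset_trans (@subsetUr _ _ _) NAB.
by move=> BA; apply: nBA; apply: subset_trans BA _; exact: subsetUr.
Qed.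

(** * Transfer of super potency to the t-operation *)

(** Enlarging a finitely generated subideal of [M] by [I] keeps it inside [M]
    and makes it star-invertible, so that its v-closure is its star-closure. *)
Lemma super_potent_t_ideal M I :
  star_ideal star M -> star_super_rigid star I -> I `<=` M ->
  star_ideal (t_op R) M.
Proof.
move=> [Mid M0 Mstar] [[[Isub _] _ Ifg _] Iinv] IM.
have Mfrac := fractional_ideal_of_ideal Mid M0.
have [Msub Mle] := Mid.
split=> //; apply/seteqP; split; last first.
  by apply: subset_trans (star_sub_t Mfrac); exact: star_subset.
move=> x [J [J0 Jfg JM] Jx].
have Jsub := fin_gen_submodule Jfg.
have Lfg := fin_gen_sum Ifg Jfg.
have LM : sum_set I J `<=` M by exact: sum_subset.
have Lid : is_ideal (sum_set I J).
  by split; [exact: fin_gen_submodule | exact: subset_trans Mle].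
have IL : I `<=` sum_set I J by apply: subset_suml; case: Jsub.
have JL : J `<=` sum_set I J by apply: subset_sumr; case: Isub.
have Linv := Iinv _ Lid Lfg IL.
rewrite -Mstar; apply: (star_mono _ Mfrac LM).
  exact: fractional_ideal_of_ideal Lid (nonzero_subset JL J0).
by apply: v_sub_star => //; exact: v_op_mono JL _ Jx.
Qed.

Lemma super_potent_maximal_t_ideal M :
  star_super_potent_ideal star M -> maximal_star_ideal (t_op R) M.
Proof.
case=> -[Mid MR Mmax] [I Irig IM]; split=> //.
  exact: super_potent_t_ideal Irig IM.
by move=> N /t_ideal_star_ideal; exact: Mmax.
Qed.

(** The super rigid ideal of [M] for [star] serves for t as well: a maximal
    t-ideal containing it is a proper star-ideal, so rigidity confines it to
    [M]. *)
Lemma super_potent_ideal_t M :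
  star_super_potent_ideal star M -> star_super_potent_ideal (t_op R) M.
Proof.
move=> Mpot; have Mt := super_potent_maximal_t_ideal Mpot.
split=> //; case: Mpot => Mstar [I [[Iid I0 Ifg [M' [_ uniq]]] Iinv] IM].
exists I => //; split; last first.
  by move=> J Jid Jfg IJ; exact/star_invertible_t/Iinv.
split=> //; exists M; split=> // N [[Nid NR Nmax] IN].
have [L Lmax NL] := exists_maximal_star_ideal (t_ideal_star_ideal Nid) NR.
have LM : L = M.
  rewrite -(uniq M) // -(uniq L) //; split=> //.
  exact: subset_trans NL.
by apply: Nmax; [case: Mt | case: Mt | rewrite -LM].
Qed.

Lemma super_potent_t : star_super_potent star -> star_super_potent (t_op R).
Proof.
move=> Rpot N Nmaxt; have [Nid NR Nmax] := Nmaxt.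
have [M Mmax NM] := exists_maximal_star_ideal (t_ideal_star_ideal Nid) NR.
have Mpot := super_potent_ideal_t (Rpot M Mmax).
suff <- : M = N by [].
by case: Mpot => -[Mid MR _] _; exact: Nmax.
Qed.

End Comparison.

Theorem corollary1p6 (R : idomainType) (star : set {fraction R} -> set {fraction R})
    (star_op : star_operation star) (star_fin : finite_type star) :
  (forall M : set {fraction R},
     star_super_potent_ideal star M -> star_super_potent_ideal (t_op R) M)
  /\ (star_super_potent star -> star_super_potent (t_op R)).
Proof.
split; first by move=> M; exact: super_potent_ideal_t.
exact: super_potent_t.
Qed.
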